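(* Let $m,n,K$ be positive integers, $q=\min\{m,n\}$, $r\in\mathbb{R}$, and let $f:\Delta^q_+\to\mathbb{R}$ be a function whose lower-level sets $\{u\in\Delta^q_+\mid f(u)\le t\}$ are semidefinite-representable. Let $\bar S=\{M\in\mathcal{M}^{m,n}(\mathbb{R})\mid\mathrm{rank}(M)\le K,\ f(\sigma(M))\le r\}$. Then $\mathrm{conv}(\bar S)$ is semidefinite-representable.
   Context: $\Delta^q_+=\{x\in\mathbb{R}^q\mid x_1\ge\dots\ge x_q\ge0\}$. $\mathcal{M}^{m,n}(\mathbb{R})$ is the space of real $m\times n$ matrices and $\sigma(M)\in\mathbb{R}^q$ its vector of singular values in nonincreasing order. A set is semidefinite-representable if it is the projection of the solution set of a linear matrix inequality (i.e., of a set $\{(x,w)\mid A_0+\sum_i x_iA_i+\sum_j w_jB_j\succeq0\}$ with symmetric matrices $A_i,B_j$). *)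

(* Defs.v *)
(* Real numbers are modelled by an arbitrary real closed
   field R. *)
From HB Require Import structures.
From mathcomp Require Import all_boot all_order all_algebra.
Set Implicit Arguments. Unset Strict Implicit. Unset Printing Implicit Defensive.
Import Order.TTheory GRing.Theory Num.Theory.
Local Open Scope ring_scope.

Section Defs.
Variable R : rcfType.

Definition in_Delta_plus (q : nat) (x : 'rV[R]_q) : Prop :=
  (forall i j : 'I_q, (i <= j)%N -> x 0 j <= x 0 i) /\
  (forall i : 'I_q, 0 <= x 0 i).

Definition symmetric_mx (k : nat) (A : 'M[R]_k) : Prop := A^T = A.

Definition psd (k : nat) (A : 'M[R]_k) : Prop :=
  symmetric_mx A /\ forall v : 'cV[R]_k, 0 <= (v^T *m A *m v) 0 0.

Definition sdr (N : nat) (S : 'rV[R]_N -> Prop) : Prop :=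
  exists (p k : nat) (A0 : 'M[R]_k) (A : 'I_N -> 'M[R]_k) (B : 'I_p -> 'M[R]_k),
    symmetric_mx A0 /\ (forall i, symmetric_mx (A i)) /\
    (forall j, symmetric_mx (B j)) /\
    forall x : 'rV[R]_N,
      S x <-> exists w : 'rV[R]_p,
        psd (A0 + \sum_(i < N) x 0 i *: A i + \sum_(j < p) w 0 j *: B j).

Definition sdr_mx (m n : nat) (S : 'M[R]_(m, n) -> Prop) : Prop :=
  sdr (fun v : 'rV[R]_(m * n) => S (vec_mx v)).

Definition conv_hull (m n : nat) (S : 'M[R]_(m, n) -> Prop)
    (M : 'M[R]_(m, n)) : Prop :=
  exists (s : nat) (l : 'I_s -> R) (X : 'I_s -> 'M[R]_(m, n)),
    (forall i, 0 <= l i) /\ \sum_(i < s) l i = 1 /\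
    (forall i, S (X i)) /\ M = \sum_(i < s) l i *: X i.

Definition orthogonal_mx (k : nat) (U : 'M[R]_k) : Prop := U^T *m U = 1%:M.

Definition rect_diag (m n : nat) (x : 'rV[R]_(minn m n)) : 'M[R]_(m, n) :=
  \matrix_(i < m, j < n)
     \sum_(k < minn m n | (val i == val k) && (val j == val k)) x 0 k.

Definition is_sing_vals (m n : nat) (M : 'M[R]_(m, n)) (x : 'rV[R]_(minn m n))
  : Prop :=
  in_Delta_plus x /\
  exists (U : 'M[R]_m) (V : 'M[R]_n),
    orthogonal_mx U /\ orthogonal_mx V /\ M = U *m rect_diag x *m V^T.

Definition Sbar (m n K : nat) (f : 'rV[R]_(minn m n) -> R) (r : R)
    (M : 'M[R]_(m, n)) : Prop :=
  (\rank M <= K)%N /\ exists x, is_sing_vals M x /\ f x <= r.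

End Defs.

(* Main.v *)
Require Import Defs.
From HB Require Import structures.
From mathcomp Require Import all_boot all_order all_algebra all_fingroup.
From mathcomp Require Import complex ring lra.
Set Implicit Arguments. Unset Strict Implicit. Unset Printing Implicit Defensive.
Import Order.TTheory GRing.Theory Num.Theory.
Local Open Scope ring_scope.

(** The convex hull of [Sbar K f r] is the set of all M whose singular values
    are weakly majorized by some u in Delta_+ with f u <= r and u_k = 0 for
    k >= K.  A Ky Fan norm constraint  sigma_0(M) + ... + sigma_c(M) <= s  is a
    linear matrix inequality with lifting variables Z, t: writing Y for the
    symmetric dilation [[0, M], [M^T, 0]], it says Z >= 0, Z + t I - Y >= 0 and
    tr Z + (c + 1) t <= s.  Hence the majorization set is semidefinite-
    representable; in particular it is convex, and as it contains [Sbar] it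
    contains the hull.  Conversely, if sigma(M) is weakly majorized by u, then
    sigma(M) is reached from u by convex combinations, coordinate permutations
    and sign changes, all of which preserve the hull of the orthogonally
    invariant set [Sbar]; the singular value decomposition transports this from
    diagonal matrices to M.  That decomposition is obtained by deflation: an
    eigenvector of Y for a nonzero eigenvalue is a pair of singular vectors. *)

Lemma widen_ord_inj m n (le_mn : (m <= n)%N) : injective (widen_ord le_mn).
Proof. by move=> i j [/val_inj]. Qed.

Lemma perm_extension (I J : finType) (h : I -> J) (s : {perm I}) :
  injective h -> exists t : {perm J}, forall i, t (h i) = h (s i).
Proof.
move=> h_inj; have [ts -> _] := prod_tpermP s; elim: ts => [|[i j] ts [t tE]].
  by exists 1%g => i; rewrite big_nil !perm1.
by exists (tperm (h i) (h j) * t)%g => k; rewrite big_cons !permM -inj_tperm.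
Qed.

Lemma card_ord_ltn q c : #|[pred k : 'I_q | (k < c)%N]| = minn c q.
Proof.
rewrite -sum1_card; have [le_cq|lt_qc] := leqP c q.
  by rewrite (big_ord_narrow le_cq) sum1_card card_ord.
rewrite (eq_bigl predT) ?sum1_card ?card_ord // => k.
by rewrite inE (ltn_trans (ltn_ord k)).
Qed.

Lemma row_sort (R : realDomainType) q (x : 'rV[R]_q) :
  exists s : 'S_q, forall i j : 'I_q, (i <= j)%N -> x 0 (s j) <= x 0 (s i).
Proof.
pose t := [tuple x 0 i | i < q].
have /tuple_permP[s sE] : perm_eq (sort (>=%R) t) t by rewrite perm_sort.
have nthE (k : 'I_q) : x 0 (s k) = nth 0 (sort (>=%R) t) k.
  by rewrite sE -tnth_nth !tnth_mktuple.
exists s => i j le_ij; rewrite !nthE.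
have sorted_t : sorted (>=%R) (sort (>=%R) t).
  by apply: sort_sorted => a b; exact: le_total.
apply: (sorted_leq_nth ge_trans ge_refl 0 sorted_t) => //.
  by rewrite inE size_sort size_tuple.
by rewrite inE size_sort size_tuple.
Qed.

Lemma ler_sum_inj (R : numDomainType) (I J : finType) (P : pred I) (h : I -> J)
    (F : J -> R) :
  injective h -> (forall j, 0 <= F j) -> \sum_(i | P i) F (h i) <= \sum_j F j.
Proof.
move=> h_inj F_ge0.
rewrite -(big_imset F (A := P) (in2W h_inj)) /= big_mkcond ler_sum // => j _.
by case: ifP.
Qed.

Section ColumnNorm.
Variable R : realDomainType.

Definition sqnorm k (v : 'cV[R]_k) : R := (v^T *m v) 0 0.

Lemma sqnormE k (v : 'cV[R]_k) : v^T *m v = (sqnorm v)%:M.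
Proof. exact: mx11_scalar. Qed.

Lemma sqnorm_sum k (v : 'cV[R]_k) : sqnorm v = \sum_i v i 0 ^+ 2.
Proof. by rewrite /sqnorm mxE; apply: eq_bigr => i _; rewrite mxE. Qed.

Lemma sqnorm_ge0 k (v : 'cV[R]_k) : 0 <= sqnorm v.
Proof. by rewrite sqnorm_sum sumr_ge0 // => i _; apply: sqr_ge0. Qed.

Lemma sqnorm_eq0 k (v : 'cV[R]_k) : (sqnorm v == 0) = (v == 0).
Proof.
apply/eqP/eqP => [|->]; last by rewrite /sqnorm mulmx0 mxE.
rewrite sqnorm_sum => /psumr_eq0P v0; apply/colP => i; apply/eqP.
by rewrite mxE -sqrf_eq0 v0 // => j _; apply: sqr_ge0.
Qed.

Lemma sqnormZ k a (v : 'cV[R]_k) : sqnorm (a *: v) = a ^+ 2 * sqnorm v.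
Proof.
rewrite /sqnorm [(_ *: v)^T]linearZ /= -scalemxAl -scalemxAr scalerA mxE.
by rewrite expr2.
Qed.

Lemma sqnorm_col_mx m n (a : 'cV[R]_m) (b : 'cV[R]_n) :
  sqnorm (col_mx a b) = sqnorm a + sqnorm b.
Proof. by rewrite /sqnorm tr_col_mx mul_row_col mxE. Qed.

End ColumnNorm.

(** * Positive semidefinite matrices *)

Section PositiveSemidefinite.
Variable R : rcfType.

Definition qform k (v : 'cV[R]_k) (A : 'M[R]_k) : R := (v^T *m A *m v) 0 0.

Lemma qform_is_scalar k (v : 'cV[R]_k) : scalar (qform v).
Proof.
by move=> a A B; rewrite /qform mulmxDr mulmxDl -scalemxAr -scalemxAl !mxE.
Qed.

HB.instance Definition _ k (v : 'cV[R]_k) :=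
  GRing.isLinear.Build R 'M[R]_k R *%R (qform v) (qform_is_scalar v).

Lemma qform_congr k l (Q : 'M[R]_(k, l)) A v :
  qform v (Q *m A *m Q^T) = qform (Q^T *m v) A.
Proof. by rewrite /qform trmx_mul trmxK !mulmxA. Qed.

Lemma qform_scalar k (v : 'cV[R]_k) t : qform v t%:M = t * sqnorm v.
Proof. by rewrite /qform mul_mx_scalar -scalemxAl mxE. Qed.

Lemma qform_outer k (w v : 'cV[R]_k) :
  qform v (w *m w^T) = (w^T *m v) 0 0 ^+ 2.
Proof.
rewrite -[w in w *m _]mulmx1 qform_congr qform_scalar mul1r.
by rewrite sqnorm_sum big_ord1.
Qed.

Lemma qform_block m n A B C D (a : 'cV[R]_m) (b : 'cV[R]_n) :
  qform (col_mx a b) (block_mx A B C D) =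
  qform a A + (a^T *m B *m b) 0 0 + (b^T *m C *m a) 0 0 + qform b D.
Proof.
rewrite /qform tr_col_mx mul_row_block mul_row_col !mulmxDl !mxE.
by rewrite addrACA !addrA.
Qed.

Lemma qform_col_mx_parallelogram m n (A : 'M[R]_(m + n)) a b :
  qform (col_mx a b) A + qform (col_mx a (- b)) A =
  2 * (qform a (ulsubmx A) + qform b (drsubmx A)).
Proof.
have oppE (B : 'M[R]_1) : (- B) 0 0 = - B 0 0 by rewrite mxE.
rewrite -[A in LHS]submxK !qform_block /qform [(- b)^T]linearN /=.
by rewrite !mulmxN !mulNmx opprK !oppE; ring.
Qed.

Lemma qform_delta k (A : 'M[R]_k) i : qform (delta_mx i 0) A = A i i.
Proof. by rewrite /qform trmx_delta -rowE -colE !mxE. Qed.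

Lemma psd0 k : psd (0 : 'M[R]_k).
Proof.
by split=> [|v]; rewrite /symmetric_mx ?trmx0 // -/(qform v 0) linear0.
Qed.

Lemma psdD k (A B : 'M[R]_k) : psd A -> psd B -> psd (A + B).
Proof.
move=> [symA posA] [symB posB]; split=> [|v].
  by rewrite /symmetric_mx linearD /= symA symB.
by rewrite -/(qform v _) linearD addr_ge0 ?posA ?posB.
Qed.

Lemma psdZ k a (A : 'M[R]_k) : 0 <= a -> psd A -> psd (a *: A).
Proof.
move=> a_ge0 [symA posA]; split=> [|v].
  by rewrite /symmetric_mx linearZ /= symA.
by rewrite -/(qform v _) linearZ mulr_ge0 ?posA.
Qed.

Lemma psd_sum (I : finType) (P : pred I) k (A : I -> 'M[R]_k) :
  (forall i, P i -> psd (A i)) -> psd (\sum_(i | P i) A i).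
Proof. by move=> posA; elim/big_ind: _ => //; [exact: psd0 | exact: psdD]. Qed.

Lemma psd_congr k l (Q : 'M[R]_(k, l)) (A : 'M[R]_l) :
  psd A -> psd (Q *m A *m Q^T).
Proof.
move=> [symA posA]; split=> [|v].
  by rewrite /symmetric_mx !trmx_mul trmxK symA mulmxA.
by rewrite -/(qform v _) qform_congr posA.
Qed.

Lemma psd_outer k (w : 'cV[R]_k) : psd (w *m w^T).
Proof.
split=> [|v]; first by rewrite /symmetric_mx trmx_mul trmxK.
by rewrite -/(qform v _) qform_outer sqr_ge0.
Qed.

Lemma psd_scalar1 (a : R) : psd (a%:M : 'M_1) <-> 0 <= a.
Proof.
split=> [[_ /(_ (delta_mx 0 0))]|a_ge0].
  by rewrite -/(qform _ _) qform_delta mxE.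
split=> [|v]; first by rewrite /symmetric_mx tr_scalar_mx.
by rewrite -/(qform v _) qform_scalar mulr_ge0 ?sqnorm_ge0.
Qed.

Lemma psd_block_diag k l (A : 'M[R]_k) (B : 'M[R]_l) :
  psd (block_mx A 0 0 B) <-> psd A /\ psd B.
Proof.
have qformE a b : qform (col_mx a b) (block_mx A 0 0 B) = qform a A + qform b B.
  by rewrite qform_block !mulmx0 !mul0mx !mxE !addr0.
split=> [[symAB posAB]|[[symA posA] [symB posB]]]; last first.
  split=> [|v]; first by rewrite /symmetric_mx tr_block_mx !trmx0 symA symB.
  by rewrite -/(qform v _) -[v]vsubmxK qformE addr_ge0 ?posA ?posB.
move: symAB; rewrite /symmetric_mx tr_block_mx !trmx0.
move=> /eq_block_mx[symA _ _ symB].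
have qform_ge0 a b : 0 <= qform a A + qform b B by rewrite -qformE posAB.
have qform_0 q (C : 'M[R]_q) : qform 0 C = 0 by rewrite /qform mulmx0 mxE.
split; split=> // v.
- by have := qform_ge0 v 0; rewrite qform_0 addr0.
- by have := qform_ge0 0 v; rewrite qform_0 add0r.
Qed.

Lemma psd_add_trmx k (A : 'M[R]_k) :
  psd A <-> symmetric_mx A /\ psd (A + A^T).
Proof.
have addE : symmetric_mx A -> A + A^T = 2 *: A.
  by move=> ->; rewrite scaler_nat mulr2n.
split=> [posA|[symA]].
  by split; [exact: posA.1 | rewrite (addE posA.1); exact: psdZ].
rewrite (addE symA) => /(@psdZ _ 2^-1); rewrite scalerA mulVf ?pnatr_eq0 //.
by rewrite scale1r; apply; rewrite invr_ge0.
Qed.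

Lemma psd_diag_ge0 k (A : 'M[R]_k) i : psd A -> 0 <= A i i.
Proof. by case=> _ posA; rewrite -qform_delta posA. Qed.

End PositiveSemidefinite.

(** * Linear matrix inequalities *)

Lemma linear_sumZ (R : pzRingType) (V U : lmodType R) (L : V -> U) (I : finType)
    (a : I -> R) (x : I -> V) :
  linear L -> L (\sum_i a i *: x i) = \sum_i a i *: L (x i).
Proof.
move=> linL.
pose L' : {linear V -> U} := HB.pack L (GRing.isLinear.Build R V U *:%R L linL).
rewrite -[L]/(L' : V -> U) linear_sum.
by apply: eq_bigr => i _; rewrite linearZ.
Qed.

Section LMI.
Import VectorInternalTheory.
Variable R : rcfType.

(* Coordinate-free version of [sdr]: lifting variables range over any finite-
   dimensional space, so products and linear preimages need no indexing. *)
Definition lmi_rep (V : lmodType R) (S : V -> Prop) : Prop :=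
  exists (W : vectType R) (k : nat) (A0 : 'M[R]_k) (L : V * W -> 'M[R]_k),
    [/\ symmetric_mx A0, linear L, forall z, symmetric_mx (L z) &
        forall x, S x <-> exists w, psd (A0 + L (x, w))].

Lemma lmi_rep_ext (V : lmodType R) (S T : V -> Prop) :
  (forall x, S x <-> T x) -> lmi_rep S -> lmi_rep T.
Proof.
move=> eST [W [k [A0 [L [symA linL symL SE]]]]].
by exists W, k, A0, L; split=> // x; rewrite -eST.
Qed.

Lemma lmi_rep_preim (V U : lmodType R) (g : U -> V) (S : V -> Prop) :
  linear g -> lmi_rep S -> lmi_rep (fun x => S (g x)).
Proof.
move=> ling [W [k [A0 [L [symA linL symL SE]]]]].
exists W, k, A0, (fun z => L (g z.1, z.2)); split=> // a u v.
by rewrite /= ling -linL.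
Qed.

Lemma lmi_rep_proj (V : lmodType R) (U : vectType R) (S : V * U -> Prop) :
  lmi_rep S -> lmi_rep (fun x => exists u, S (x, u)).
Proof.
move=> [W [k [A0 [L [symA linL symL SE]]]]].
exists (U * W)%type, k, A0, (fun z => L ((z.1, z.2.1), z.2.2)).
split=> // [a u v|x]; first by rewrite /= -linL.
split=> [[u /SE[w posL]]|[[u w] posL]]; first by exists (u, w).
by exists u; apply/SE; exists w.
Qed.

Lemma lmi_rep_and (V : lmodType R) (S T : V -> Prop) :
  lmi_rep S -> lmi_rep T -> lmi_rep (fun x => S x /\ T x).
Proof.
move=> [W [k [A0 [L [symA linL symL SE]]]]].
move=> [W' [k' [A0' [L' [symA' linL' symL' TE]]]]].
exists (W * W')%type, (k + k')%N, (block_mx A0 0 0 A0'),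
  (fun z => block_mx (L (z.1, z.2.1)) 0 0 (L' (z.1, z.2.2))); split.
- by rewrite /symmetric_mx tr_block_mx !trmx0 symA symA'.
- move=> a [x [w w']] [y [v v']] /=.
  rewrite scale_block_mx add_block_mx !scaler0 !addr0.
  by congr block_mx; [rewrite -linL | rewrite -linL'].
- by move=> z; rewrite /symmetric_mx tr_block_mx !trmx0 symL symL'.
- move=> x; rewrite SE TE; split=> [[[w posL] [w' posL']]|[[w w']]].
    by exists (w, w'); rewrite add_block_mx !addr0 psd_block_diag.
  rewrite add_block_mx !addr0 psd_block_diag /= => -[posL posL'].
  by split; [exists w | exists w'].
Qed.

Lemma lmi_rep_psd_symmetric (V : lmodType R) k (F : V -> 'M[R]_k) :
  linear F -> (forall x, symmetric_mx (F x)) -> lmi_rep (fun x => psd (F x)).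
Proof.
move=> linF symF; exists 'rV[R]_0, k, 0, (fun z => F z.1); split=> //.
- by rewrite /symmetric_mx trmx0.
- by move=> a u v /=; rewrite linF.
- by move=> x; split=> [posF|[w]]; rewrite ?add0r //; exists 0; rewrite add0r.
Qed.

Lemma lmi_rep_ge0 (V : lmodType R) (F : V -> R^o) :
  linear F -> lmi_rep (fun x => 0 <= F x).
Proof.
move=> linF; apply: (@lmi_rep_ext _ (fun x => psd ((F x)%:M : 'M_1))).
  by move=> x; rewrite psd_scalar1.
apply: lmi_rep_psd_symmetric => [a u v|x].
  by rewrite /= linF raddfD /= scale_scalar_mx.
by rewrite /symmetric_mx tr_scalar_mx.
Qed.

Lemma lmi_rep_eq0 (V : lmodType R) (F : V -> R^o) :
  linear F -> lmi_rep (fun x => F x = 0).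
Proof.
move=> linF; have linNF : linear (fun x => - F x : R^o).
  by move=> a u v; rewrite linF opprD scalerN.
apply: lmi_rep_ext (lmi_rep_and (lmi_rep_ge0 linF) (lmi_rep_ge0 linNF)) => x.
rewrite oppr_ge0; split=> [[Fge0 Fle0]|->]; last by rewrite lexx.
by apply/eqP; rewrite eq_le Fge0 Fle0.
Qed.

Lemma lmi_rep_forall (V : lmodType R) (I : finType) (P : pred I)
    (S : I -> V -> Prop) :
  (forall i, P i -> lmi_rep (S i)) -> lmi_rep (fun x => forall i, P i -> S i x).
Proof.
move=> repS; suff rep_seq (s : seq I) : all P s ->
    lmi_rep (fun x => forall i, i \in s -> S i x).
  apply: lmi_rep_ext (rep_seq (enum P) _) => [x|].
    by split=> Sx i iP; apply: Sx; rewrite mem_enum in iP *.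
  by apply/allP => i; rewrite mem_enum.
elim: s => [_|i s IHs /= /andP[Pi Ps]].
  have : lmi_rep (fun x : V => (0 : R^o) = 0).
    by apply: lmi_rep_eq0 => a u v; rewrite scaler0 addr0.
  by apply: lmi_rep_ext => x; split.
apply: lmi_rep_ext (lmi_rep_and (repS i Pi) (IHs Ps)) => x; split.
  by move=> [Si Ss] j; rewrite inE => /predU1P[->|/Ss].
by move=> Ss; split=> [|j js]; apply: Ss; rewrite inE ?eqxx ?js ?orbT.
Qed.

Lemma lmi_rep_symmetric (V : lmodType R) k (F : V -> 'M[R]_k) :
  linear F -> lmi_rep (fun x => symmetric_mx (F x)).
Proof.
move=> linF.
apply: (@lmi_rep_ext _ (fun x => forall ij, true ->
    F x ij.1 ij.2 - F x ij.2 ij.1 = 0 :> R^o)).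
  move=> x; split=> [symF|symF [i j] _ /=]; last first.
    by rewrite -[in X in _ - X]symF mxE subrr.
  apply/matrixP => i j; rewrite mxE; apply/eqP.
  by rewrite -subr_eq0 (symF (j, i)).
apply: lmi_rep_forall => -[i j] _; apply: lmi_rep_eq0 => a u v /=.
by rewrite linF !mxE scalerBr opprD addrACA.
Qed.

Lemma lmi_rep_psd (V : lmodType R) k (F : V -> 'M[R]_k) :
  linear F -> lmi_rep (fun x => psd (F x)).
Proof.
move=> linF.
apply: lmi_rep_ext (lmi_rep_and (lmi_rep_symmetric linF) _) => [x|].
  exact: iff_sym (psd_add_trmx (F x)).
apply: lmi_rep_psd_symmetric => [a u v|x].
  by rewrite linF linearP scalerDr addrACA.
by rewrite /symmetric_mx linearD /= trmxK addrC.
Qed.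

Lemma lmi_rep_convex (V : lmodType R) (S : V -> Prop) (I : finType) (l : I -> R)
    (X : I -> V) : lmi_rep S -> (forall i, 0 <= l i) ->
  \sum_i l i = 1 -> (forall i, S (X i)) -> S (\sum_i l i *: X i).
Proof.
move=> [W [k [A0 [L [symA linL symL SE]]]]] l_ge0 l_sum1 SX.
have /fin_all_exists[w posL] i : exists w, psd (A0 + L (X i, w)) by apply/SE.
apply/SE; exists (\sum_i l i *: w i).
have -> : (\sum_i l i *: X i, \sum_i l i *: w i) = \sum_i l i *: (X i, w i).
  rewrite [RHS]surjective_pairing; congr pair.
    by rewrite (big_morph (fun z : V * W => z.1) (id1 := 0) (op1 := +%R)).
  by rewrite (big_morph (fun z : V * W => z.2) (id1 := 0) (op1 := +%R)).
rewrite linear_sumZ // -[A0]scale1r -l_sum1 scaler_suml -big_split /=.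
by apply: psd_sum => i _; rewrite -scalerDr; apply: psdZ.
Qed.

Lemma sdr_lmi_rep N (S : 'rV[R]_N -> Prop) : sdr S -> lmi_rep S.
Proof.
move=> [p [k [A0 [A [B [symA0 [symA [symB SE]]]]]]]].
exists 'rV[R]_p, k, A0,
  (fun z : 'rV[R]_N * 'rV[R]_p =>
     \sum_i z.1 0 i *: A i + \sum_j z.2 0 j *: B j).
split=> // [a u v|z|x].
- rewrite /= scalerDr addrACA !scaler_sumr -!big_split /=.
  by congr (_ + _); apply: eq_bigr => i _; rewrite !mxE scalerDl scalerA.
- rewrite /symmetric_mx linearD /= !linear_sum /=.
  by congr (_ + _); apply: eq_bigr => i _; rewrite linearZ /= ?symA ?symB.
- by rewrite SE; split=> -[w posx]; exists w; move: posx; rewrite addrA.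
Qed.

Lemma lmi_rep_sdr N (S : 'rV[R]_N -> Prop) : lmi_rep S -> sdr S.
Proof.
move=> [W [k [A0 [L [symA linL symL SE]]]]].
exists (dim W), k, A0, (fun i => L (delta_mx 0 i, 0)),
   (fun j => L (0, r2v (delta_mx 0 j))).
do 3! [split=> //]; move=> x; rewrite SE.
have LE w : L (x, r2v w) = \sum_(i < N) x 0 i *: L (delta_mx 0 i, 0) +
    \sum_j w 0 j *: L (0, r2v (delta_mx 0 j)).
  have -> : (x, r2v w) = 1 *: (x, 0) + (0, r2v w).
    by rewrite scale1r; congr pair; rewrite /= ?addr0 ?add0r.
  rewrite linL scale1r {1}(row_sum_delta x) {1}(row_sum_delta w); congr (_ + _).
    rewrite (@linear_sumZ _ _ _ (fun x => L (x, 0))) // => a u v.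
    by rewrite -linL; congr L; congr pair; rewrite /= scaler0 addr0.
  rewrite (@linear_sumZ _ _ _ (fun w => L (0, r2v w))) // => a u v.
  by rewrite -linL; congr L; congr pair; rewrite /= ?linearP // scaler0 addr0.
split=> -[w posL].
  by exists (v2r w); rewrite -addrA -LE v2rK.
by exists (r2v w); rewrite LE addrA.
Qed.

End LMI.

(** * Singular value decomposition *)

Section HermitianEigenvalues.
Local Open Scope sesquilinear_scope.
Variables (C : numClosedFieldType) (n : nat).
Implicit Types A : 'M[C]_n.

Lemma eigenvalue_hermsymmx_real A a :
  A \is hermsymmx -> eigenvalue A a -> a \is Num.real.
Proof.
move=> /is_hermitianmxP; rewrite expr0 scale1r => hermA.
move=> /eigenvalueP[v vA v_neq0].
have dotvA : dotmx (v *m A) v = dotmx v (v *m A).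
  by rewrite !dotmxE trmx_mul map_mxM -hermA mulmxA.
apply/CrealP; move: dotvA; rewrite vA linearZl_LR linearZr_LR /=.
by move/(mulIf (lt0r_neq0 (dotmx_is_dotmx v_neq0))) <-.
Qed.

Lemma normalmx_neq0_eigenvalue A :
  A \is normalmx -> A != 0 -> exists2 a, a != 0 & eigenvalue A a.
Proof.
move=> /orthomx_spectralP AE; pose P := spectralmx A; pose d := spectral_diag A.
have PAE : P *m A = diag_mx d *m P.
  by rewrite [A in LHS]AE !mulmxA mulmxV ?mul1mx ?spectral_unit.
move=> A_neq0; have /rV0Pn[i di_neq0] : d != 0.
  by apply: contraNneq A_neq0 => d0; rewrite AE -/d d0 linear0 mulmx0 mul0mx.
exists (d 0 i) => //; apply/eigenvalueP; exists (row i P).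
  by rewrite -row_mul PAE row_mul row_diag_mx -scalemxAl -rowE.
apply: contraTneq (spectral_unit A) => rowP0.
rewrite -row_free_unit -kermx_eq0; apply/rowV0Pn; exists (delta_mx 0 i).
  by apply/sub_kermxP; rewrite -rowE.
by apply/eqP => /rowP/(_ i)/eqP; rewrite !mxE !eqxx oner_eq0.
Qed.

End HermitianEigenvalues.

Lemma symmetric_mx_neq0_eigenvalue (R : rcfType) n (A : 'M[R]_n) :
  symmetric_mx A -> A != 0 -> exists2 a, a != 0 & eigenvalue A a.
Proof.
move=> symA A_neq0; pose AC := map_mx (real_complex R) A.
have hermA : AC \is hermsymmx.
  apply/is_hermitianmxP; rewrite expr0 scale1r; apply/matrixP => i j.
  by rewrite !mxE -[in LHS]symA mxE; exact/esym/conjc_real.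
have [|a a_neq0 eigA] := normalmx_neq0_eigenvalue (hermitian_normalmx hermA).
  by rewrite map_mx_eq0.
have /complex_realP[b aE] := eigenvalue_hermsymmx_real hermA eigA.
exists b; first by move: a_neq0; rewrite aE fmorph_eq0.
by move: eigA; rewrite aE eigenvalue_map.
Qed.

Section OrthogonalMatrices.
Variable R : rcfType.

Lemma orthogonal_mxV k (U : 'M[R]_k) : orthogonal_mx U -> U *m U^T = 1%:M.
Proof. exact: mulmx1C. Qed.

Lemma orthogonal_mxM k (U V : 'M[R]_k) :
  orthogonal_mx U -> orthogonal_mx V -> orthogonal_mx (U *m V).
Proof.
move=> orthU orthV.
by rewrite /orthogonal_mx trmx_mul mulmxA -[_ *m U]mulmxA orthU mulmx1.
Qed.

Lemma orthogonal_mx_tr k (U : 'M[R]_k) : orthogonal_mx U -> orthogonal_mx U^T.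
Proof. by move=> orthU; rewrite /orthogonal_mx trmxK orthogonal_mxV. Qed.

Lemma orthogonal_mx1 k : orthogonal_mx (1%:M : 'M[R]_k).
Proof. by rewrite /orthogonal_mx trmx1 mulmx1. Qed.

Lemma orthogonal_mx_unit k (U : 'M[R]_k) : orthogonal_mx U -> U \in unitmx.
Proof. by move=> /mulmx1_unit[]. Qed.

Lemma orthogonal_mx_mulKV m n (U : 'M[R]_m) (V : 'M[R]_n) M :
  orthogonal_mx U -> orthogonal_mx V -> U^T *m (U *m M *m V^T) *m V = M.
Proof.
by move=> orthU orthV; rewrite !mulmxA orthU mul1mx -mulmxA orthV mulmx1.
Qed.

Lemma orthogonal_perm_mx k (s : 'S_k) : orthogonal_mx (perm_mx s : 'M[R]_k).
Proof. by rewrite /orthogonal_mx tr_perm_mx -perm_mxM mulVg perm_mx1. Qed.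

Lemma orthogonal_diag_sign k (c : pred 'I_k) :
  orthogonal_mx (diag_mx (\row_i (-1) ^+ c i) : 'M[R]_k).
Proof.
rewrite /orthogonal_mx tr_diag_mx mulmx_diag; apply/matrixP => i j.
by rewrite !mxE -expr2 sqrr_sign.
Qed.

Lemma orthogonal_block_mx k l (U : 'M[R]_k) (V : 'M[R]_l) :
  orthogonal_mx U -> orthogonal_mx V -> orthogonal_mx (block_mx U 0 0 V).
Proof.
move=> orthU orthV; rewrite /orthogonal_mx tr_block_mx !trmx0 mulmx_block.
by rewrite !mulmx0 !mul0mx !addr0 add0r orthU orthV -scalar_mx_block.
Qed.

(* The identity when [w = 0], since then [2 / sqnorm w = 0]. *)
Definition reflection k (w : 'cV[R]_k) : 'M[R]_k :=
  1%:M - (2 / sqnorm w) *: (w *m w^T).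

Lemma orthogonal_reflection k (w : 'cV[R]_k) : orthogonal_mx (reflection w).
Proof.
have tr_reflection : (reflection w)^T = reflection w.
  by rewrite /reflection linearB /= trmx1 linearZ /= trmx_mul trmxK.
rewrite /orthogonal_mx tr_reflection /reflection mulmxBl mul1mx mulmxBr mulmx1.
rewrite -scalemxAl -scalemxAr [w *m w^T *m _]mulmxA -[w *m _ *m w]mulmxA.
rewrite sqnormE mul_mx_scalar -scalemxAl !scalerA.
 have [->|w_neq0] := eqVneq (sqnorm w) 0.
  by rewrite invr0 !(mulr0, scale0r, subr0).
have -> : 2 / sqnorm w * (2 / sqnorm w) * sqnorm w =
    2 / sqnorm w + 2 / sqnorm w by field.
by rewrite scalerDl opprB addrK subrK.
Qed.

Lemma mul_reflection_sub k (v w : 'cV[R]_k) :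
  sqnorm v = sqnorm w -> reflection (v - w) *m v = w.
Proof.
move=> eq_sqnorm; have [->|] := eqVneq v w.
  by rewrite /reflection subrr mul0mx scaler0 subr0 mul1mx.
rewrite -subr_eq0 -sqnorm_eq0 /reflection; set d := v - w => d_neq0.
have dv : d^T *m v = (sqnorm d / 2)%:M.
  rewrite [LHS]mx11_scalar; congr (_%:M).
  have : 2 * (d^T *m v) 0 0 - sqnorm d = sqnorm v - sqnorm w.
    rewrite !sqnorm_sum mxE mulr_sumr -!sumrB; apply: eq_bigr => i _.
    by rewrite !mxE; ring.
  by rewrite eq_sqnorm subrr; lra.
rewrite mulmxBl mul1mx -scalemxAl -mulmxA dv mul_mx_scalar scalerA.
have -> : 2 / sqnorm d * (sqnorm d / 2) = 1 by field.
by rewrite scale1r /d opprB addrC subrK.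
Qed.

Lemma orthogonal_completion n (v : 'cV[R]_(1 + n)) : sqnorm v = 1 ->
  exists2 U : 'M[R]_(1 + n), orthogonal_mx U & U *m col_mx 1%:M 0 = v.
Proof.
move=> v_unit; pose e : 'cV[R]_(1 + n) := col_mx 1%:M 0.
exists (reflection (e - v)); first exact: orthogonal_reflection.
apply: mul_reflection_sub.
rewrite v_unit sqnorm_col_mx !sqnorm_sum big_ord1 !mxE.
by rewrite big1 ?addr0 ?expr1n // => i _; rewrite mxE expr0n.
Qed.

End OrthogonalMatrices.

Section Dilation.
Variables (R : rcfType) (m n : nat).

Definition dilation (M : 'M[R]_(m, n)) : 'M[R]_(m + n) := block_mx 0 M M^T 0.

Lemma dilation_is_linear : linear dilation.
Proof.
move=> a M N; rewrite /dilation scale_block_mx add_block_mx !scaler0 !addr0.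
by rewrite linearP.
Qed.

HB.instance Definition _ := GRing.isLinear.Build R 'M[R]_(m, n) 'M[R]_(m + n)
  *:%R dilation dilation_is_linear.

Lemma symmetric_dilation M : symmetric_mx (dilation M).
Proof. by rewrite /symmetric_mx tr_block_mx !trmx0 trmxK. Qed.

Lemma dilation_eq0 M : (dilation M == 0) = (M == 0).
Proof.
by rewrite block_mx_eq0 trmx_eq0 !eqxx /= andbT andbb.
Qed.

Lemma dilation_congr (U : 'M[R]_m) (V : 'M[R]_n) M :
  dilation (U *m M *m V^T) =
  block_mx U 0 0 V *m dilation M *m (block_mx U 0 0 V)^T.
Proof.
rewrite /dilation tr_block_mx !trmx0 !mulmx_block.
by rewrite !(mulmx0, mul0mx, addr0, add0r) !trmx_mul trmxK mulmxA.
Qed.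

Lemma qform_dilation M a b :
  qform (col_mx a b) (dilation M) = 2 * (a^T *m M *m b) 0 0.
Proof.
rewrite qform_block /qform !mulmx0 !mul0mx mxE add0r addr0.
have -> : (b^T *m M^T *m a) 0 0 = (b^T *m M^T *m a)^T 0 0 by rewrite [RHS]mxE.
by rewrite !trmx_mul !trmxK mulmxA mulrDl !mul1r.
Qed.

End Dilation.

Section SingularValueDecomposition.
Variable R : rcfType.

Lemma singular_pair m n (M : 'M[R]_(m, n)) : M != 0 ->
  exists s (u : 'cV[R]_m) (v : 'cV[R]_n),
    [/\ sqnorm u = 1, sqnorm v = 1, M *m v = s *: u & u^T *m M = s *: v^T].
Proof.
rewrite -dilation_eq0 => /(symmetric_mx_neq0_eigenvalue (symmetric_dilation M)).
move=> [s s_neq0 /eigenvalueP[w]]; rewrite -[w]hsubmxK.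
move: (lsubmx w) (rsubmx w) => a b; rewrite mul_row_block !mulmx0 add0r addr0.
rewrite scale_row_mx => /eq_row_mx[bM aM] ab_neq0.
have Mb : M *m b^T = s *: a^T by rewrite -linearZ -bM /= trmx_mul trmxK.
have eq_sqnorm : sqnorm a^T = sqnorm b^T.
  apply: (mulfI s_neq0); rewrite /sqnorm !trmxK.
  have -> : s * (a *m a^T) 0 0 = (a *m (M *m b^T)) 0 0.
    by rewrite Mb -scalemxAr [RHS]mxE.
  by rewrite mulmxA aM -scalemxAl mxE.
have b_gt0 : 0 < sqnorm b^T.
  rewrite lt0r sqnorm_ge0 andbT; apply: contra ab_neq0 => b0.
  move: (b0); rewrite -{1}eq_sqnorm !sqnorm_eq0 !trmx_eq0 in b0 *.
  by move=> /eqP->; rewrite (eqP b0) row_mx0.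
pose c := (Num.sqrt (sqnorm b^T))^-1.
have c_unit : c ^+ 2 * sqnorm b^T = 1.
  by rewrite exprVn sqr_sqrtr ?ltW // mulVf ?gt_eqF.
exists s, (c *: a^T), (c *: b^T); split.
- by rewrite sqnormZ eq_sqnorm.
- by rewrite sqnormZ.
- by rewrite -scalemxAr Mb !scalerA mulrC.
- by rewrite !linearZ /= !trmxK -scalemxAl aM !scalerA mulrC.
Qed.

Lemma singular_pair_deflation m n (M : 'M[R]_(1 + m, 1 + n)) s u v :
  sqnorm u = 1 -> sqnorm v = 1 -> M *m v = s *: u -> u^T *m M = s *: v^T ->
  exists U V N, [/\ orthogonal_mx U, orthogonal_mx V &
    M = U *m block_mx s%:M 0 0 N *m V^T].
Proof.
move=> u_unit v_unit Mv uM.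
have [U orthU Ue] := orthogonal_completion u_unit.
have [V orthV Ve] := orthogonal_completion v_unit.
pose N : 'M_(1 + m, 1 + n) := U^T *m M *m V.
have NE : M = U *m N *m V^T.
  rewrite /N !mulmxA orthogonal_mxV // mul1mx -mulmxA orthogonal_mxV //.
  by rewrite mulmx1.
have first_colN : N *m col_mx 1%:M 0 = s *: col_mx 1%:M 0.
  by rewrite /N -!mulmxA Ve Mv -Ue -!scalemxAr mulmxA orthU mul1mx.
have first_rowN : row_mx 1%:M 0 *m N = s *: row_mx 1%:M 0.
  have row_e k : row_mx 1%:M 0 = (col_mx 1%:M 0 : 'cV[R]_(1 + k))^T.
    by rewrite tr_col_mx trmx1 trmx0.
  rewrite /N !mulmxA !row_e -trmx_mul Ue uM -Ve trmx_mul.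
  by rewrite -scalemxAl -mulmxA orthV mulmx1.
exists U, V, (drsubmx N); split=> //; rewrite {1}NE; congr (_ *m _ *m _).
move: first_colN first_rowN; rewrite -[N]submxK.
rewrite mul_block_col mul_row_block scale_col_mx scale_row_mx !mulmx1 !mul1mx.
rewrite !mulmx0 !mul0mx !addr0 !scaler0 scale_scalar_mx mulr1 block_mxKdr.
by move=> /eq_col_mx[-> ->] /eq_row_mx[_ ->].
Qed.

Lemma exists_orthogonal_diag m n (M : 'M[R]_(m, n)) :
  exists U V D, [/\ orthogonal_mx U, orthogonal_mx V, is_diag_mx D &
                    M = U *m D *m V^T].
Proof.
have zero_case m' n' : exists U V (D : 'M[R]_(m', n')),
    [/\ orthogonal_mx U, orthogonal_mx V, is_diag_mx D & 0 = U *m D *m V^T].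
  exists 1%:M, 1%:M, 0; rewrite mulmx0 mul0mx.
  by split; [exact: orthogonal_mx1.. | exact: mx0_is_diag |].
elim: n m M => [|n IHn] m M; first by rewrite (thinmx0 M).
have [->|M_neq0] := eqVneq M 0; first exact: zero_case.
case: m M M_neq0 => [|m] M M_neq0; first by rewrite flatmx0 eqxx in M_neq0.
have [s [u [v [u_unit v_unit Mv uM]]]] := singular_pair M_neq0.
have [U [V [N [orthU orthV ->]]]] :=
  singular_pair_deflation u_unit v_unit Mv uM.
have [U' [V' [D [orthU' orthV' diagD ->]]]] := IHn _ N.
have diagB : is_diag_mx (block_mx s%:M 0 0 D : 'M_(1 + m, 1 + n)).
  by rewrite is_diag_block_mx // !eqxx scalar_mx_is_diag.
have blockE : block_mx s%:M 0 0 (U' *m D *m V'^T) = block_mx 1%:M 0 0 U' *m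
    block_mx s%:M 0 0 D *m (block_mx 1%:M 0 0 V')^T :> 'M_(1 + m, 1 + n).
  rewrite tr_block_mx !trmx0 trmx1 !mulmx_block.
  by rewrite !(mulmx0, mul0mx, addr0, add0r, mul1mx, mulmx1).
exists (U *m block_mx 1%:M 0 0 U'), (V *m block_mx 1%:M 0 0 V').
exists (block_mx s%:M 0 0 D : 'M_(1 + m, 1 + n)); split=> //.
- exact/(orthogonal_mxM orthU)/orthogonal_block_mx/orthU'/orthogonal_mx1.
- exact/(orthogonal_mxM orthV)/orthogonal_block_mx/orthV'/orthogonal_mx1.
- by rewrite blockE trmx_mul !mulmxA.
Qed.

End SingularValueDecomposition.

(** * Singular values *)

Local Notation diag_row := (widen_ord (geq_minl _ _)).
Local Notation diag_col := (widen_ord (geq_minr _ _)).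

Section RectDiag.
Variables (R : rcfType) (m n : nat).
Implicit Types (x : 'rV[R]_(minn m n)) (k : 'I_(minn m n)).

Lemma rect_diagE x :
  rect_diag x = \sum_k x 0 k *: delta_mx (diag_row k) (diag_col k).
Proof.
apply/matrixP=> i j; rewrite mxE summxE big_mkcond; apply: eq_bigr => k _.
by rewrite !mxE -!val_eqE /=; case: (_ && _); rewrite ?mulr1 ?mulr0.
Qed.

Lemma rect_diag_is_linear : linear (@rect_diag R m n).
Proof.
move=> a x y; rewrite !rect_diagE scaler_sumr -big_split; apply: eq_bigr => k _.
by rewrite !mxE scalerDl scalerA.
Qed.

HB.instance Definition _ :=
  GRing.isLinear.Build R 'rV[R]_(minn m n) 'M[R]_(m, n) *:%R
    (@rect_diag R m n) rect_diag_is_linear.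

Lemma rect_diag_bilinear x (a : 'cV[R]_m) (b : 'cV[R]_n) :
  (a^T *m rect_diag x *m b) 0 0 =
  \sum_k x 0 k * (a (diag_row k) 0 * b (diag_col k) 0).
Proof.
rewrite rect_diagE mulmx_sumr mulmx_suml summxE; apply: eq_bigr => k _.
rewrite -scalemxAr -scalemxAl mxE -(mul_delta_mx (0 : 'I_1)) -!mulmxA.
by rewrite -rowE mulmxA -colE mxE big_ord1 !mxE.
Qed.

Lemma rect_diag_id x k : rect_diag x (diag_row k) (diag_col k) = x 0 k.
Proof. by rewrite mxE (big_pred1 k) // => l; rewrite /= andbb eq_sym. Qed.

Lemma is_diag_rect_diag (D : 'M[R]_(m, n)) :
  is_diag_mx D -> exists x, D = rect_diag x.
Proof.
move=> /is_diag_mxP diagD; exists (\row_k D (diag_row k) (diag_col k)).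
apply/matrixP=> i j; have [eq_ij|neq_ij] := eqVneq (i : nat) j.
  have lt_iq : (i < minn m n)%N by rewrite leq_min ltn_ord eq_ij ltn_ord.
  have -> : i = diag_row (Ordinal lt_iq) by apply: val_inj.
  have -> : j = diag_col (Ordinal lt_iq) by apply: val_inj.
  by rewrite rect_diag_id mxE.
rewrite diagD // mxE big_pred0 // => k.
by apply: contraNF neq_ij => /andP[/eqP-> /eqP->].
Qed.

Lemma mxrank_rect_diag x : \rank (rect_diag x) = #|[pred k | x 0 k != 0]|.
Proof.
pose e k : 'rV[R]_n := delta_mx 0 (diag_col k).
have /mxdirectP/= rank_sum : mxdirect (\sum_(k | x 0 k != 0) <<e k>>).
  by apply: mxdirect_delta => k l _ _; exact: widen_ord_inj.
suff -> : \rank (rect_diag x) = \rank (\sum_(k | x 0 k != 0) <<e k>>)%MS.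
  rewrite rank_sum -sum1_card; apply: eq_bigr => k _.
  by rewrite mxrank_gen mxrank_delta.
apply/eqP; rewrite eqn_leq; apply/andP; split; apply/mxrankS.
  rewrite rect_diagE summx_sub // => k _; have [->|xk_neq0] := eqVneq (x 0 k) 0.
    by rewrite scale0r sub0mx.
  rewrite scalemx_sub // (sumsmx_sup k) // genmxE -(mul_delta_mx (0 : 'I_1)).
  exact: submxMl.
apply/sumsmx_subP => k xk_neq0; rewrite genmxE.
suff <- : (x 0 k)^-1 *: row (diag_row k) (rect_diag x) = e k.
  by rewrite scalemx_sub ?row_sub.
rewrite rect_diagE linear_sum (bigD1 k) //= big1 ?addr0 => [|l l_neq_k].
  by rewrite linearZ /= rowE mul_delta_mx scalerA mulVf // scale1r.
by rewrite linearZ /= rowE mul_delta_mx_0 ?scaler0 // -val_eqE eq_sym.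
Qed.

End RectDiag.

Section SingularValues.
Variables (R : rcfType) (m n : nat).
Implicit Types (x : 'rV[R]_(minn m n)) (M : 'M[R]_(m, n)).

Definition orthogonally_invariant (S : 'M[R]_(m, n) -> Prop) :=
  forall U V M, orthogonal_mx U -> orthogonal_mx V -> S M -> S (U *m M *m V^T).

Lemma orthogonally_invariantE S U V M : orthogonally_invariant S ->
  orthogonal_mx U -> orthogonal_mx V -> S (U *m M *m V^T) <-> S M.
Proof.
move=> invS orthU orthV; split; last exact: invS.
move=> /(invS _ _ _ (orthogonal_mx_tr orthU) (orthogonal_mx_tr orthV)).
by rewrite trmxK orthogonal_mx_mulKV.
Qed.

Definition sign_row q (c : pred 'I_q) (x : 'rV[R]_q) : 'rV[R]_q :=
  \row_k ((-1) ^+ c k * x 0 k).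

Lemma orthogonally_invariant_sign_row S (c : pred 'I_(minn m n)) x :
  orthogonally_invariant S -> S (rect_diag x) -> S (rect_diag (sign_row c x)).
Proof.
move=> invS Sx; pose d i := [exists k, c k && (diag_row k == i)].
have dE k : d (diag_row k) = c k.
  apply/existsP/idP => [[l /andP[cl /eqP/widen_ord_inj <-]] //|ck].
  by exists k; rewrite ck eqxx.
suff -> : rect_diag (sign_row c x) =
    diag_mx (\row_i (-1) ^+ d i) *m rect_diag x *m 1%:M^T.
  exact: invS (orthogonal_diag_sign _ _) (orthogonal_mx1 _ _) Sx.
rewrite trmx1 mulmx1 !rect_diagE mulmx_sumr; apply: eq_bigr => k _.
rewrite -scalemxAr mxE mulrC -scalerA; congr (_ *: _).
rewrite mul_diag_mx; apply/matrixP=> i j; rewrite !mxE.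
by case: eqP => [->|_]; rewrite ?dE //= !mulr0.
Qed.

Lemma orthogonally_invariant_col_perm S (s : 'S_(minn m n)) x :
  orthogonally_invariant S -> S (rect_diag x) -> S (rect_diag (col_perm s x)).
Proof.
move=> invS Sx.
have [t tE] := perm_extension s (@widen_ord_inj _ _ (geq_minl m n)).
have [t' tE'] := perm_extension s (@widen_ord_inj _ _ (geq_minr m n)).
suff -> : rect_diag (col_perm s x) = perm_mx t *m rect_diag x *m (perm_mx t')^T.
  exact: invS (orthogonal_perm_mx _ _) (orthogonal_perm_mx _ _) Sx.
rewrite tr_perm_mx -row_permE -col_permE !rect_diagE.
rewrite [in RHS](reindex_inj (@perm_inj _ s)) /=; apply/matrixP=> i j.
rewrite !mxE !summxE; apply: eq_bigr => k _; rewrite !mxE -tE -tE'.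
by rewrite !(inj_eq perm_inj).
Qed.

Lemma is_sing_vals_rect_diag x :
  in_Delta_plus x -> is_sing_vals (rect_diag x) x.
Proof.
move=> Dx; split=> //; exists 1%:M, 1%:M.
by rewrite trmx1 mul1mx mulmx1; do ![split; first exact: orthogonal_mx1].
Qed.

Lemma is_sing_vals_invariant x :
  orthogonally_invariant (fun M => is_sing_vals M x).
Proof.
move=> U V M orthU orthV [Dx [A [B [orthA [orthB ->]]]]]; split=> //.
exists (U *m A), (V *m B); do 2! [split; first exact: orthogonal_mxM].
by rewrite trmx_mul !mulmxA.
Qed.

Lemma orthogonally_invariant_sing_vals S M x :
  orthogonally_invariant S -> is_sing_vals M x -> S M <-> S (rect_diag x).
Proof.
by move=> invS [_ [U [V [orthU [orthV ->]]]]]; exact: orthogonally_invariantE.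
Qed.

Lemma exists_sing_vals M : exists x, is_sing_vals M x.
Proof.
pose S N := exists x, is_sing_vals N x.
have invS : orthogonally_invariant S.
  by move=> U V N orthU orthV [x sx]; exists x; exact: is_sing_vals_invariant.
have [U [V [D [orthU orthV /is_diag_rect_diag[d ->] ->]]]] :=
  exists_orthogonal_diag M.
apply/(orthogonally_invariantE _ invS) => //.
pose e : 'rV[R]_(minn m n) := \row_k `|d 0 k|.
have -> : d = sign_row (fun k => d 0 k < 0) e.
  by apply/rowP=> k; rewrite !mxE mulr_sign_norm.
apply: orthogonally_invariant_sign_row => //; have [s sorted_e] := row_sort e.
have -> : e = col_perm s^-1 (col_perm s e).
  by rewrite -col_permM mulVg col_perm1.
apply: orthogonally_invariant_col_perm => //; exists (col_perm s e).
apply: is_sing_vals_rect_diag; split=> [i j /sorted_e|i]; first by rewrite !mxE.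
by rewrite !mxE.
Qed.

Lemma mxrank_sing_vals M x :
  is_sing_vals M x -> \rank M = #|[pred k | x 0 k != 0]|.
Proof.
move=> [_ [U [V [orthU [orthV ->]]]]].
rewrite mxrankMfree ?row_free_unit ?unitmx_tr ?orthogonal_mx_unit //.
by rewrite eqmxMfull ?row_full_unit ?orthogonal_mx_unit // mxrank_rect_diag.
Qed.

Lemma mxrank_sing_vals_leq K M x : is_sing_vals M x ->
  (\rank M <= K)%N <-> forall k : 'I_(minn m n), (K <= k)%N -> x 0 k = 0.
Proof.
move=> sx; have [[x_sorted x_ge0] _] := sx; rewrite (mxrank_sing_vals sx).
split=> [rankK k leKk|x0].
  apply/eqP; apply: contraTT rankK => xk_neq0; rewrite -ltnNge.
  have -> : K.+1 = minn K.+1 (minn m n).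
    by apply/esym/minn_idPl/(leq_ltn_trans leKk).
  rewrite -(card_ord_ltn _ K.+1); apply/subset_leq_card/subsetP => l.
  rewrite !inE ltnS => le_lK.
  apply: lt0r_neq0; apply: lt_le_trans (x_sorted _ _ (leq_trans le_lK leKk)).
  by rewrite lt0r xk_neq0 x_ge0.
apply: leq_trans (geq_minl K (minn m n)); rewrite -(card_ord_ltn _ K).
apply/subset_leq_card/subsetP => k; rewrite !inE ltnNge.
by apply: contraNN => /x0->.
Qed.

End SingularValues.

(** * Weak majorization *)

Definition convex_set (R : numDomainType) (V : lmodType R) (S : V -> Prop) :=
  forall a x y, 0 <= a <= 1 -> S x -> S y -> S (a *: x + (1 - a) *: y).

Section Majorization.
Variables (R : rcfType) (q : nat).
Implicit Types (x u : 'rV[R]_q) (c i j k : 'I_q).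

Definition prefix_sum c x : R := \sum_(k < q | (k <= c)%N) x 0 k.

Lemma prefix_sum_is_scalar c : scalar (prefix_sum c).
Proof.
move=> a x y; rewrite /prefix_sum mulr_sumr -big_split; apply: eq_bigr => k _.
by rewrite !mxE.
Qed.

HB.instance Definition _ c :=
  GRing.isLinear.Build R 'rV[R]_q R *%R (prefix_sum c) (prefix_sum_is_scalar c).

Lemma prefix_sum_delta c i : prefix_sum c (delta_mx 0 i) = (i <= c)%N%:R.
Proof.
rewrite /prefix_sum big_mkcond (bigD1 i) //= big1 => [|k /negPf k_neq_i].
  by rewrite addr0 mxE !eqxx; case: ifP.
by rewrite mxE k_neq_i andbF if_same.
Qed.

Definition weakly_majorized x u := forall c, prefix_sum c x <= prefix_sum c u.

Definition transfer i j (d : R) u := u + d *: (delta_mx 0 j - delta_mx 0 i).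

Lemma transferE i j d u k : i != j ->
  transfer i j d u 0 k =
  if k == i then u 0 i - d else if k == j then u 0 j + d else u 0 k.
Proof.
move=> i_neq_j; rewrite !mxE /=; have [->|_] := eqVneq k i.
  by rewrite (negPf i_neq_j) sub0r mulrN1.
by have [->|_] := eqVneq k j; rewrite ?subr0 ?mulr1 // mulr0 addr0.
Qed.

Lemma prefix_sum_transfer c i j d u : prefix_sum c (transfer i j d u) =
  prefix_sum c u + d * ((j <= c)%N%:R - (i <= c)%N%:R).
Proof. by rewrite /transfer linearD linearZ linearB /= !prefix_sum_delta. Qed.

Lemma transfer_weakly_majorized x u i j d :
  (i < j)%N -> 0 <= d <= u 0 i - x 0 i ->
  (forall k, (k < j)%N -> x 0 k <= u 0 k) ->
  weakly_majorized x u -> weakly_majorized x (transfer i j d u).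
Proof.
move=> lt_ij /andP[d_ge0 d_le] x_le_u xu c.
have i_neq_j : i != j by rewrite -val_eqE ltn_eqF.
have [le_jc|lt_cj] := leqP j c.
  rewrite prefix_sum_transfer le_jc (leq_trans (ltnW lt_ij) le_jc) subrr mulr0.
  by rewrite addr0.
apply: ler_sum => k le_kc; have lt_kj := leq_ltn_trans le_kc lt_cj.
rewrite transferE //; case: eqP => [->|_]; first by lra.
by rewrite -val_eqE ltn_eqF // x_le_u.
Qed.

Lemma weakly_majorized_deficit x u j0 :
  weakly_majorized x u -> u 0 j0 < x 0 j0 ->
  exists i j, [/\ (i < j)%N, x 0 i < u 0 i, u 0 j < x 0 j &
                  forall k, (k < j)%N -> x 0 k <= u 0 k].
Proof.
move=> xu ltj0.
have [j ltj jmin] := @arg_minnP _ j0 (fun j => u 0 j < x 0 j) val ltj0.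
have x_le_u k : (k < j)%N -> x 0 k <= u 0 k.
  by move=> lt_kj; rewrite leNgt; apply/negP => /jmin; rewrite leqNgt lt_kj.
have [i /andP[lt_ij lti]|no_surplus] :=
  pickP (fun i => (i < j)%N && (x 0 i < u 0 i)).
  by exists i, j.
have := xu j; rewrite leNgt /prefix_sum (bigD1 j) //= [ltRHS](bigD1 j) //=.
rewrite ltr_leD // ler_sum // => k /andP[le_kj k_neq_j].
have := no_surplus k; rewrite ltn_neqAle k_neq_j le_kj /= => /negbT.
by rewrite -leNgt.
Qed.

Definition mismatch x u := #|[pred k | x 0 k != u 0 k]|.

Lemma mismatch_ltn x u u' i :
  (forall k, x 0 k = u 0 k -> x 0 k = u' 0 k) ->
  x 0 i != u 0 i -> x 0 i = u' 0 i -> (mismatch x u' < mismatch x u)%N.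
Proof.
move=> agree neq_i eq_i; apply/proper_card/properP; split.
  by apply/subsetP=> k; rewrite !inE; apply: contraNN => /eqP/agree->.
by exists i; rewrite !inE // eq_i eqxx.
Qed.

Variable G : 'rV[R]_q -> Prop.
Hypothesis convexG : convex_set G.
Hypothesis signG : forall (c : pred 'I_q) x, G x -> G (sign_row c x).
Hypothesis permG : forall (s : 'S_q) x, G x -> G (col_perm s x).

Lemma shrink_closed u j a : `|a| <= u 0 j -> G u ->
  G (\row_k if k == j then a else u 0 k).
Proof.
rewrite ler_norml => /andP[ge_a le_a] Gu.
have [u0|uj_neq0] := eqVneq (u 0 j) 0.
  suff <- : u = \row_k if k == j then a else u 0 k by [].
  by apply/rowP=> k; rewrite mxE; case: eqP => // ->; lra.
have uj_gt0 : 0 < u 0 j by rewrite lt0r uj_neq0; lra.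
pose l := (1 + a / u 0 j) / 2.
have l01 : 0 <= l <= 1.
  have : -1 <= a / u 0 j <= 1.
    by rewrite ler_pdivlMr // ler_pdivrMr // mulN1r mul1r ge_a.
  by rewrite /l; lra.
suff <- : l *: u + (1 - l) *: sign_row (pred1 j) u =
    \row_k if k == j then a else u 0 k.
  by apply: convexG => //; exact: signG.
apply/rowP=> k; rewrite !mxE /=; case: eqP => [->|_]; rewrite /l.
  by field.
by rewrite expr0 mul1r; ring.
Qed.

Lemma transfer_closed u i j d :
  0 <= d <= u 0 i - u 0 j -> G u -> G (transfer i j d u).
Proof.
move=> /andP[d_ge0 d_le] Gu; have [d0|d_neq0] := eqVneq d 0.
  by rewrite /transfer d0 scale0r addr0.
have gap_gt0 : 0 < u 0 i - u 0 j by rewrite (lt_le_trans _ d_le) // lt0r d_neq0.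
pose l := d / (u 0 i - u 0 j).
have l01 : 0 <= l <= 1.
  by rewrite divr_ge0 ?(ltW gap_gt0) //= ler_pdivrMr // mul1r.
have dE : d = l * (u 0 i - u 0 j) by rewrite divfK // gt_eqF.
have i_neq_j : i != j by apply: contraTneq gap_gt0 => ->; rewrite subrr ltxx.
suff <- : l *: col_perm (tperm i j) u + (1 - l) *: u = transfer i j d u.
  by apply: convexG => //; exact: permG.
apply/rowP=> k; rewrite transferE // !mxE dE.
by case: tpermP => [->|->|/eqP/negPf-> /eqP/negPf->];
   rewrite ?eqxx 1?eq_sym ?(negPf i_neq_j); ring.
Qed.

Lemma dominated_closed x u : (forall k, 0 <= x 0 k <= u 0 k) -> G u -> G x.
Proof.
have [N] := ubnP (mismatch x u).
elim: N u => // N IHN u; rewrite ltnS => le_N xu Gu.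
have [j neq_j|eq_xu] := pickP (fun j => x 0 j != u 0 j); last first.
  suff -> : x = u by [].
  by apply/rowP => k; apply/eqP; rewrite -[_ == _]negbK eq_xu.
apply: (IHN (\row_k if k == j then x 0 j else u 0 k)).
- apply: leq_trans le_N; apply: (mismatch_ltn (i := j)); rewrite ?mxE ?eqxx //.
  by move=> k eq_k; rewrite mxE; case: eqP => [->|].
- move=> k; rewrite mxE; case: eqP => [->|//].
  by rewrite lexx andbT; case/andP: (xu j).
- apply: shrink_closed => //; have /andP[x_ge0 le_xu] := xu j.
  by rewrite ger0_norm.
Qed.

(* The transfer is the largest one not overshooting [x 0 i] or [x 0 j], so that
   one of these two coordinates comes to agree. *)
Lemma exists_closer_majorant x u j0 : in_Delta_plus x -> weakly_majorized x u ->
  u 0 j0 < x 0 j0 -> G u ->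
  exists u',
    [/\ G u', weakly_majorized x u' & (mismatch x u' < mismatch x u)%N].
Proof.
move=> [x_sorted _] xu /(weakly_majorized_deficit xu).
move=> [i [j [lt_ij lti ltj x_le_u]]] Gu.
have le_xji : x 0 j <= x 0 i by apply: x_sorted; apply: ltnW.
have i_neq_j : i != j by rewrite -val_eqE ltn_eqF.
pose d := Num.min (u 0 i - x 0 i) (x 0 j - u 0 j).
have d_ge0 : 0 <= d by rewrite le_min !subr_ge0 !ltW.
have le_di : d <= u 0 i - x 0 i by rewrite ge_min lexx.
have le_dj : d <= x 0 j - u 0 j by rewrite ge_min lexx orbT.
exists (transfer i j d u); split.
- by apply: transfer_closed => //; lra.
- by apply: transfer_weakly_majorized; rewrite ?d_ge0.
have agree k : x 0 k = u 0 k -> x 0 k = transfer i j d u 0 k.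
  rewrite transferE // => eq_k; case: eqP => [ki|_].
    by move: lti; rewrite -ki eq_k ltxx.
  by case: eqP => [kj|//]; move: ltj; rewrite -kj eq_k ltxx.
have [dE|dE] : d = u 0 i - x 0 i \/ d = x 0 j - u 0 j.
- by rewrite /d; case: leP; [left | right].
- apply: (mismatch_ltn (i := i)); rewrite ?lt_eqF // transferE // eqxx dE.
  by rewrite subKr.
- apply: (mismatch_ltn (i := j)); rewrite ?gt_eqF // transferE // eqxx eq_sym.
  by rewrite (negPf i_neq_j) dE addrC subrK.
Qed.

Lemma weakly_majorized_closed x u :
  in_Delta_plus x -> weakly_majorized x u -> G u -> G x.
Proof.
move=> Dx; have [N] := ubnP (mismatch x u).
elim: N u => // N IHN u; rewrite ltnS => le_N xu Gu.
have [j ltj|x_le_u] := pickP (fun j => u 0 j < x 0 j).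
  have [u' [Gu' xu' lt_mismatch]] := exists_closer_majorant Dx xu ltj Gu.
  exact: IHN (leq_trans lt_mismatch le_N) xu' Gu'.
apply: dominated_closed Gu => k; by rewrite Dx.2 leNgt x_le_u.
Qed.

End Majorization.

(** * Ky Fan norms *)

Section KyFan.
Variables (R : rcfType) (m n : nat).
Implicit Types (x : 'rV[R]_(minn m n)) (M : 'M[R]_(m, n)).

(* The linear matrix inequality expressing that the sum of the [c] largest
   singular values of [M] is at most [s]; [Z] and [t] are dual variables. *)
Definition kyfan_lmi (c : nat) M (s : R) :=
  exists (Z : 'M[R]_(m + n)) (t : R),
    [/\ psd Z, psd (Z + t%:M - dilation M) & \tr Z + t *+ c <= s].

Lemma kyfan_lmi_monotone c M s s' :
  s <= s' -> kyfan_lmi c M s -> kyfan_lmi c M s'.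
Proof.
move=> le_ss' [Z [t [posZ posY trZ]]]; exists Z, t.
by split=> //; apply: le_trans le_ss'.
Qed.

Lemma kyfan_lmi_invariant c s :
  orthogonally_invariant (fun M => kyfan_lmi c M s).
Proof.
move=> U V M orthU orthV [Z [t [posZ posY trZ]]]; pose Q := block_mx U 0 0 V.
have orthQ : orthogonal_mx Q by apply: orthogonal_block_mx.
exists (Q *m Z *m Q^T), t; split; first exact: psd_congr.
  have -> : t%:M = Q *m t%:M *m Q^T.
    by rewrite mul_mx_scalar -scalemxAl orthogonal_mxV // scalemx1.
  rewrite dilation_congr -mulmxDl -mulmxBl -mulmxDr -mulmxBr.
  exact: psd_congr.
by rewrite mxtrace_mulC mulmxA orthQ mul1mx.
Qed.

(* Add the inequalities obtained by testing [Z + t%:M - dilation (rect_diag x)]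
   on [e_k + f_k] and [Z] on [e_k - f_k], for [e_k] and [f_k] the k-th basis
   vectors of the two summands. *)
Lemma kyfan_lmi_sum_le (P : pred 'I_(minn m n)) x s :
  kyfan_lmi #|P| (rect_diag x) s -> \sum_(k in P) x 0 k <= s.
Proof.
move=> [Z [t [posZ posY]]]; apply: le_trans.
pose il (k : 'I_(minn m n)) := lshift n (diag_row k).
pose ir (k : 'I_(minn m n)) := rshift m (diag_col k).
have x_le k : x 0 k <= Z (il k) (il k) + Z (ir k) (ir k) + t.
  pose a : 'cV[R]_m := delta_mx (diag_row k) 0.
  pose b : 'cV[R]_n := delta_mx (diag_col k) 0.
  have sqnorm_delta l (i : 'I_l) : sqnorm (delta_mx i 0 : 'cV[R]_l) = 1.
    by rewrite /sqnorm trmx_delta mul_delta_mx mxE !eqxx.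
  have abx : (a^T *m rect_diag x *m b) 0 0 = x 0 k.
    by rewrite trmx_delta -rowE -colE 2!mxE rect_diag_id.
  have := posZ.2 (col_mx a (- b)); have := posY.2 (col_mx a b).
  rewrite -!/(qform _ _) linearB linearD /= qform_dilation abx qform_scalar.
  rewrite sqnorm_col_mx !sqnorm_delta; have := qform_col_mx_parallelogram Z a b.
  by rewrite !qform_delta !mxE; lra.
rewrite -sumr_const.
apply: le_trans (ler_sum _ (fun k _ => x_le k)) _.
rewrite big_split /= lerD2r big_split /= /mxtrace big_split_ord /=.
apply: lerD; apply: (ler_sum_inj _ (@widen_ord_inj _ _ _)
  (F := fun i => Z (_ i) (_ i))) => i; exact: psd_diag_ge0.
Qed.

Definition diag_pair k : 'cV[R]_(m + n) :=
  col_mx (delta_mx (diag_row k) 0) (delta_mx (diag_col k) 0).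

(* The excess over [t] of the entries retained by [P] is put on the eigenvectors
   [diag_pair k] of the dilation. *)
Definition excess_mx (P : pred 'I_(minn m n)) x t : 'M[R]_(m + n) :=
  \sum_(k in P) ((x 0 k - t) / 2) *: (diag_pair k *m (diag_pair k)^T).

Lemma psd_excess_mx (P : pred 'I_(minn m n)) x t :
  (forall k, k \in P -> t <= x 0 k) -> psd (excess_mx P x t).
Proof.
move=> t_le_x; apply: psd_sum => k /t_le_x le_tx; apply: psdZ (psd_outer _).
by rewrite divr_ge0 // subr_ge0.
Qed.

Lemma mxtrace_excess_mx (P : pred 'I_(minn m n)) x t :
  \tr (excess_mx P x t) + t *+ #|P| = \sum_(k in P) x 0 k.
Proof.
rewrite linear_sum -sumr_const -big_split; apply: eq_bigr => k _ /=.
rewrite mxtraceZ mxtrace_mulC trace_mx11 tr_col_mx mul_row_col !trmx_delta.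
by rewrite !mul_delta_mx !mxE !eqxx /=; field.
Qed.

Lemma qform_excess_mx (P : pred 'I_(minn m n)) x t a b :
  qform (col_mx a b) (excess_mx P x t) =
  \sum_(k in P) (x 0 k - t) / 2 * (a (diag_row k) 0 + b (diag_col k) 0) ^+ 2.
Proof.
rewrite linear_sum; apply: eq_bigr => k _.
rewrite linearZ /= qform_outer tr_col_mx mul_row_col !trmx_delta mxE.
by rewrite -!rowE !mxE.
Qed.

Lemma sqnorm_col_mx_ge (a : 'cV[R]_m) (b : 'cV[R]_n) :
  \sum_k (a (diag_row k) 0 ^+ 2 + b (diag_col k) 0 ^+ 2) <= sqnorm (col_mx a b).
Proof.
have sqnorm_widen_le p q (le_pq : (p <= q)%N) (v : 'cV[R]_q) :
    \sum_k v (widen_ord le_pq k) 0 ^+ 2 <= sqnorm v.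
  rewrite sqnorm_sum.
  apply: (ler_sum_inj _ (@widen_ord_inj _ _ _) (F := fun i => v i 0 ^+ 2)) => i.
  exact: sqr_ge0.
by rewrite sqnorm_col_mx big_split lerD.
Qed.

Lemma psd_excess_mx_sub_dilation (P : pred 'I_(minn m n)) x t : 0 <= t ->
  (forall k, k \in P -> t <= x 0 k) ->
  (forall k, k \notin P -> `|x 0 k| <= t) ->
  psd (excess_mx P x t + t%:M - dilation (rect_diag x)).
Proof.
move=> t_ge0 t_le_x x_le_t; split=> [|v].
  rewrite /symmetric_mx linearB linearD /= tr_scalar_mx symmetric_dilation.
  by rewrite (psd_excess_mx t_le_x).1.
rewrite -/(qform v _) -[v]vsubmxK linearB linearD /= qform_scalar.
move: (usubmx v) (dsubmx v) => a b.
rewrite qform_dilation rect_diag_bilinear qform_excess_mx big_mkcond.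
have le_sqnorm := ler_wpM2l t_ge0 (sqnorm_col_mx_ge a b).
apply: le_trans (lerB (lerD (lexx _) le_sqnorm) (lexx _)).
rewrite !mulr_sumr -big_split -sumrB; apply: sumr_ge0 => k _ /=.
move: (a _ _) (b _ _) (t_le_x k) (x_le_t k) => ak bk.
case: ifP => [_ /(_ isT) le_tx _|_ _ /(_ isT)].
  have -> : (x 0 k - t) / 2 * (ak + bk) ^+ 2 + t * (ak ^+ 2 + bk ^+ 2) -
      2 * (x 0 k * (ak * bk)) = (x 0 k + t) / 2 * (ak - bk) ^+ 2 by field.
  by rewrite mulr_ge0 ?sqr_ge0 //; lra.
rewrite ler_norml => le_xt.
have -> : 0 + t * (ak ^+ 2 + bk ^+ 2) - 2 * (x 0 k * (ak * bk)) =
    (t - x 0 k) / 2 * (ak + bk) ^+ 2 + (t + x 0 k) / 2 * (ak - bk) ^+ 2.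
  by field.
by rewrite addr_ge0 // mulr_ge0 ?sqr_ge0 //; lra.
Qed.

Lemma kyfan_lmi_threshold (P : pred 'I_(minn m n)) x t : 0 <= t ->
  (forall k, k \in P -> t <= x 0 k) ->
  (forall k, k \notin P -> `|x 0 k| <= t) ->
  kyfan_lmi #|P| (rect_diag x) (\sum_(k in P) x 0 k).
Proof.
move=> t_ge0 t_le_x x_le_t; exists (excess_mx P x t), t; split.
- exact: psd_excess_mx.
- exact: psd_excess_mx_sub_dilation.
- by rewrite mxtrace_excess_mx.
Qed.

Lemma kyfan_lmi_sing_vals (c : 'I_(minn m n)) M x s : is_sing_vals M x ->
  kyfan_lmi c.+1 M s <-> prefix_sum c x <= s.
Proof.
move=> sx; have [[x_sorted x_ge0] _] := sx.
have card_c : #|[pred k : 'I_(minn m n) | (k <= c)%N]| = c.+1.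
  by rewrite (card_ord_ltn _ c.+1); apply/minn_idPl.
have invS := @kyfan_lmi_invariant c.+1 s.
apply: iff_trans (orthogonally_invariant_sing_vals invS sx) _.
rewrite -card_c; split=> [/kyfan_lmi_sum_le //|/kyfan_lmi_monotone]; apply.
apply: (kyfan_lmi_threshold (t := x 0 c)) => // k; rewrite inE.
  exact: x_sorted.
by rewrite -ltnNge ger0_norm // => /ltnW/x_sorted.
Qed.

Lemma lmi_rep_kyfan c :
  lmi_rep (fun p : 'M[R]_(m, n) * R^o => kyfan_lmi c p.1 p.2).
Proof.
pose V := ('M[R]_(m, n) * R^o * ('M[R]_(m + n) * R^o))%type.
pose S (v : V) := psd v.2.1 /\ (psd (v.2.1 + v.2.2%:M - dilation v.1.1) /\
  0 <= v.1.2 - (\tr v.2.1 + v.2.2 *+ c)).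
suff repS : lmi_rep S.
  apply: lmi_rep_ext (lmi_rep_proj repS) => p.
  split=> [[[Z t] [posZ [posY trZ]]]|[Z [t [posZ posY trZ]]]].
    by exists Z, t; split; rewrite // -subr_ge0.
  by exists (Z, t); rewrite /S /= subr_ge0.
apply: lmi_rep_and; last apply: lmi_rep_and.
- by apply: lmi_rep_psd => a u v.
- apply: lmi_rep_psd => a u v /=; rewrite linearP; apply/matrixP => i j.
  by rewrite !mxE -[a *: u.2.2]/(a * u.2.2); ring.
- apply: lmi_rep_ge0 => a u v /=; rewrite linearP /=.
  by rewrite /GRing.scale /=; ring.
Qed.

End KyFan.

(** * Convex hulls *)

Section ConvexHull.
Variables (R : rcfType) (m n : nat) (S : 'M[R]_(m, n) -> Prop).

Lemma conv_hull_sub M : S M -> conv_hull S M.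
Proof.
move=> SM; exists 1, (fun=> 1), (fun=> M).
by rewrite !big_ord1 scale1r; split=> // _; exact: ler01.
Qed.

Lemma conv_hull_convex : convex_set (conv_hull S).
Proof.
move=> a M N /andP[a_ge0 a_le1] [s [l [X [l_ge0 [l_sum1 [SX ->]]]]]].
move=> [t [k [Y [k_ge0 [k_sum1 [SY ->]]]]]].
exists (s + t)%N,
  (fun i => match split i with inl i => a * l i | inr j => (1 - a) * k j end),
  (fun i => match split i with inl i => X i | inr j => Y j end).
have splitl i : split (lshift t i : 'I_(s + t)) = inl i := unsplitK (inl i).
have splitr j : split (rshift s j : 'I_(s + t)) = inr j := unsplitK (inr j).
split; first by move=> i; case: split => j; rewrite mulr_ge0 ?subr_ge0.
split.
  rewrite big_split_ord /=; under eq_bigr do rewrite splitl.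
  under [X in _ + X]eq_bigr do rewrite splitr.
  by rewrite -!mulr_sumr l_sum1 k_sum1 !mulr1 subrKC.
split; first by move=> i; case: split.
rewrite [RHS]big_split_ord /= !scaler_sumr.
by congr (_ + _); apply: eq_bigr => i _; rewrite ?splitl ?splitr scalerA.
Qed.

Lemma conv_hull_min_lmi_rep (T : 'M[R]_(m, n) -> Prop) :
  lmi_rep T -> (forall M, S M -> T M) -> forall M, conv_hull S M -> T M.
Proof.
move=> repT sub_ST M [s [l [X [l_ge0 [l_sum1 [SX ->]]]]]].
by apply: (lmi_rep_convex repT) => // i; apply: sub_ST.
Qed.

Lemma conv_hull_invariant :
  orthogonally_invariant S -> orthogonally_invariant (conv_hull S).
Proof.
move=> invS U V M orthU orthV [s [l [X [l_ge0 [l_sum1 [SX ->]]]]]].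
exists s, l, (fun i => U *m X i *m V^T); do 2! [split=> //]; split=> [i|].
  exact: invS.
rewrite mulmx_sumr mulmx_suml; apply: eq_bigr => i _.
by rewrite -scalemxAr -scalemxAl.
Qed.

End ConvexHull.

Lemma sing_vals_weakly_majorized_closed (R : rcfType) (m n : nat)
    (S : 'M[R]_(m, n) -> Prop) M x u :
  convex_set S -> orthogonally_invariant S -> is_sing_vals M x ->
  weakly_majorized x u -> S (rect_diag u) -> S M.
Proof.
move=> convS invS sx xu Su; apply/(orthogonally_invariant_sing_vals invS sx).
pose G y := S (rect_diag y).
apply: (weakly_majorized_closed (G := G) _ _ _ sx.1 xu Su).
- by move=> a y z a01 Sy Sz; rewrite /G linearD !linearZ; apply: convS.
- by move=> c y; apply: orthogonally_invariant_sign_row.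
- by move=> s y; apply: orthogonally_invariant_col_perm.
Qed.

Section SpectralSublevelHull.
Variables (R : rcfType) (m n K : nat) (f : 'rV[R]_(minn m n) -> R) (r : R).

Lemma Sbar_invariant : orthogonally_invariant (Sbar (m := m) K f r).
Proof.
move=> U V M orthU orthV [rankM [x [sx fx]]].
have sx' := is_sing_vals_invariant orthU orthV sx.
split; last by exists x.
exact/(mxrank_sing_vals_leq _ sx')/(mxrank_sing_vals_leq _ sx).
Qed.

Definition majorized_Sbar (M : 'M[R]_(m, n)) := exists u,
  [/\ in_Delta_plus u /\ f u <= r,
      forall k : 'I_(minn m n), (K <= k)%N -> u 0 k = 0 &
      forall c : 'I_(minn m n), kyfan_lmi c.+1 M (prefix_sum c u)].

Lemma lmi_rep_majorized_Sbar :
  sdr (fun u => in_Delta_plus u /\ f u <= r) -> lmi_rep majorized_Sbar.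
Proof.
move=> /sdr_lmi_rep rep_f.
pose T (p : 'M[R]_(m, n) * 'rV[R]_(minn m n)) :=
  (in_Delta_plus p.2 /\ f p.2 <= r) /\
  ((forall k : 'I_(minn m n), (K <= k)%N -> p.2 0 k = 0) /\
   forall c : 'I_(minn m n), true -> kyfan_lmi c.+1 p.1 (prefix_sum c p.2)).
suff repT : lmi_rep T.
  apply: lmi_rep_ext (lmi_rep_proj repT) => M.
  split=> [[u [fu [u0 ky]]]|[u [fu u0 ky]]]; exists u; last by split.
  by split=> // c; apply: ky.
apply: lmi_rep_and; first exact: (lmi_rep_preim (g := snd)) rep_f.
apply: lmi_rep_and; last first.
  apply: lmi_rep_forall => c _.
  pose g (p : 'M[R]_(m, n) * 'rV[R]_(minn m n)) :=
    (p.1, prefix_sum c p.2 : R^o).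
  have ling : linear g by move=> a p p'; rewrite /g /= linearP.
  exact: (lmi_rep_preim ling (@lmi_rep_kyfan R m n c.+1)).
by apply: lmi_rep_forall => k _; apply: lmi_rep_eq0 => a u v; rewrite !mxE.
Qed.

Lemma conv_hull_SbarE M : sdr (fun u => in_Delta_plus u /\ f u <= r) ->
  conv_hull (Sbar K f r) M <-> majorized_Sbar M.
Proof.
move=> sdr_f; split.
  apply: (conv_hull_min_lmi_rep (lmi_rep_majorized_Sbar sdr_f)) => {}M.
  move=> [rankM [x [sx fx]]]; exists x; split.
  - by split=> //; case: sx.
  - exact/mxrank_sing_vals_leq/rankM.
  - by move=> c; apply/(kyfan_lmi_sing_vals _ _ sx).
move=> [u [[Du fu] u0 ky]]; have [x sx] := exists_sing_vals M.
have su := is_sing_vals_rect_diag Du.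
apply: (sing_vals_weakly_majorized_closed _ _ sx (u := u)).
- exact: conv_hull_convex.
- exact/conv_hull_invariant/Sbar_invariant.
- by move=> c; apply/(kyfan_lmi_sing_vals _ _ sx).
- apply: conv_hull_sub; split; last by exists u.
  exact/(mxrank_sing_vals_leq _ su).
Qed.

End SpectralSublevelHull.

Theorem mainTheorem11 (R : rcfType) (m n K : nat)
  (hm : (0 < m)%N) (hn : (0 < n)%N) (hK : (0 < K)%N)
  (r : R) (f : 'rV[R]_(minn m n) -> R)
  (hf : forall t : R, sdr (fun u : 'rV[R]_(minn m n) => in_Delta_plus u /\ f u <= t)) :
  sdr_mx (conv_hull (Sbar K f r)).
Proof.
apply: lmi_rep_sdr; apply: (lmi_rep_preim (g := vec_mx)); first exact: linearP.
apply: lmi_rep_ext (lmi_rep_majorized_Sbar K (hf r)) => M.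
exact: iff_sym (conv_hull_SbarE K M (hf r)).
Qed.
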